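(* Let $(X,\tau,\mathfrak{a})$ be an $\mathfrak{a}$-space. If $A\subseteq X$ is compact in $(X,\tau)$, then $A$ is $\mathfrak{a}$-compact.
   Context: An aura topological space (or $\mathfrak{a}$-space) $(X,\tau,\mathfrak{a})$ is a topological space $(X,\tau)$ together with a function $\mathfrak{a}:X\to\tau$ (a scope function) such that $x\in\mathfrak{a}(x)$ for every $x\in X$. A subset $A\subseteq X$ is $\mathfrak{a}$-open if $\mathfrak{a}(x)\subseteq A$ for every $x\in A$; the collection $\tau_{\mathfrak{a}}$ of all $\mathfrak{a}$-open sets is a topology on $X$ with $\tau_{\mathfrak{a}}\subseteq\tau$. A subset $A\subseteq X$ is $\mathfrak{a}$-compact if every cover of $A$ by members of $\tau_{\mathfrak{a}}$ has a finite subcover. *)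

(* Defs.v *)
From HB Require Import structures.
From mathcomp Require Import all_boot all_order.
From mathcomp Require Import classical_sets cardinality topology.

Set Implicit Arguments.
Unset Strict Implicit.
Unset Printing Implicit Defensive.

Local Open Scope classical_set_scope.

(* An aura topological space is a topological space X together with
   an element of [scope_function X]. *)
Record scope_function (X : topologicalType) := ScopeFunction {
  scope_fun :> X -> set X;
  scope_open : forall x, open (scope_fun x);
  scope_mem : forall x, scope_fun x x
}.

Definition aura_open (X : topologicalType) (a : scope_function X) : set (set X) :=
  [set A | forall x, A x -> a x `<=` A].

Definition aura_compact (X : topologicalType) (a : scope_function X) (A : set X) :=
  forall C : set (set X),
    C `<=` aura_open a -> A `<=` \bigcup_(U in C) U ->
    exists C' : set (set X),
      [/\ C' `<=` C, finite_set C' & A `<=` \bigcup_(U in C') U].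

(* Main.v *)
Require Import Defs.
From HB Require Import structures.
From mathcomp Require Import all_boot all_order.
From mathcomp Require Import classical_sets cardinality topology.
From mathcomp Require Import boolp finmap.

Local Open Scope classical_set_scope.

(** An [a]-open set contains the open set [a x] around each of its points [x], so it is open. Hence
    a cover by [a]-open sets is an open cover, and compactness in its [cover_compact] form gives a
    finite subcover. *)

Lemma aura_open_open (X : topologicalType) (a : scope_function X) (U : set X) :
  aura_open a U -> open U.
Proof.
move=> aU; rewrite openE => x Ux.
apply: (filterS (aU x Ux)).
exact: open_nbhs_nbhs (conj (scope_open a x) (scope_mem a x)).
Qed.

(* The library's [compact_cover] asks for a pointed space; a nonempty [A]
   provides a point. *)
Lemma compact_cover_compact (X : topologicalType) (A : set X) :
  compact A -> cover_compact A.
Proof.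
have [[x _]|/nonemptyPn -> _ I D f _ _] := pselect (A !=set0); last first.
  by exists fset0 => // y.
pose pX : ptopologicalType := HB.pack_for ptopologicalType X (isPointed.Build X x).
(* [pX] carries the topology of [X], so the two statements are convertible. *)
move=> cA; suff: @cover_compact pX A by [].
by rewrite -compact_cover.
Qed.

Theorem theorem3p3 (X : topologicalType) (a : scope_function X) (A : set X) :
  compact A -> aura_compact a A.
Proof.
move=> /compact_cover_compact cA C Ca AC.
(* The cover is indexed by itself through [id], so the finite index set [D] is already the
   subcover. *)
have [U /Ca/aura_open_open //|D DC AD] := cA (set X) C id _ AC.
by exists [set` D]; split=> [U /DC /set_mem||] //; exact: finite_fset.
Qed.
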